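(* Let $(\Sigma,A)$ be a finitary algebra whose underlying set $A$ is finite. Then the finitary double centralizer $(\Sigma^A)^{\perp\perp(\aleph_0)}$ is the set of all finitary operations $f:A^n \rightarrow A$ such that $h(f) = f\bigl((h(\pi_i))_{i \in n}\bigr)$ for every $\Sigma$-homomorphism $h:A^{(A^n)} \rightarrow A$, where $\pi_i:A^n\to A$ $(i\in n)$ denote the projections.
   Context: A finitary operation on a set $A$ is a map $A^n\to A$ with $n$ a finite cardinal ($n=\{0,\dots,n-1\}$; $n=0$ is allowed). A finitary signature is a set $\Sigma$ with an assignment of a finite cardinal, its arity, to each $\sigma\in\Sigma$. A $\Sigma$-algebra is a set $A$ equipped with an operation $\sigma^A:A^n\to A$ for each $\sigma\in\Sigma$, where $n$ is the arity of $\sigma$; a $\Sigma$-homomorphism is a map preserving these basic operations. A finitary algebra is a pair $(\Sigma,A)$ of a finitary signature $\Sigma$ and a $\Sigma$-algebra $A$; write $\Sigma^A=\{\sigma^A\mid\sigma\in\Sigma\}$. Each power $A^Y$ is a $\Sigma$-algebra under the pointwise operations; in particular $A^{(A^n)}$ is a $\Sigma$-algebra. Operations $f:A^n\to A$ and $g:A^m\to A$ commute, written $f\perp g$, if for every matrix $a=(a_{ij})\in A^{n\times m}$ one has $g\bigl((f((a_{ij})_{i\in n}))_{j\in m}\bigr)=f\bigl((g((a_{ij})_{j\in m}))_{i\in n}\bigr)$. For a set $G$ of finitary operations on $A$, $G^{\perp(\aleph_0)}$ is the set of all finitary operations $f$ on $A$ with $f\perp g$ for all $g\in G$, and $G^{\perp\perp(\aleph_0)}$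 is the result of applying $(-)^{\perp(\aleph_0)}$ twice to $G$. In $h(f)$, the map $f:A^n\to A$ is regarded as an element of $A^{(A^n)}$. *)

(* Defs.v *)
From HB Require Import structures.
From mathcomp Require Import all_boot all_algebra.
From mathcomp Require Import boolp classical_sets.

Set Implicit Arguments.
Unset Strict Implicit.
Unset Printing Implicit Defensive.

Local Open Scope classical_set_scope.

(* The underlying sets are finite types, possibly empty, so the powers A^n and
   A^(A^n) are types of finite functions, and an n-ary operation on A is
   literally an element of A^(A^n). *)
Definition operation (A : finType) (n : nat) : finType :=
  {ffun {ffun 'I_n -> A} -> A}.

Definition finop (A : finType) := {n : nat & operation A n}.

Definition commute (A : finType) (n m : nat)
    (f : operation A n) (g : operation A m) : Prop :=
  forall a : 'M[A]_(n, m),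
    g [ffun j => f [ffun i => a i j]] = f [ffun i => g [ffun j => a i j]].

Definition centralizer (A : finType) (G : set (finop A)) : set (finop A) :=
  [set f | forall g, G g -> commute (tagged f) (tagged g)].

Definition double_centralizer (A : finType) (G : set (finop A)) :
    set (finop A) := centralizer (centralizer G).

Record signature := Signature {
  symbol :> Type;
  arity : symbol -> nat
}.

Record finalgebra (S : signature) := FinAlgebra {
  carrier :> finType;
  interp : forall s : S, operation carrier (arity s)
}.

Definition basic_ops (S : signature) (A : finalgebra S) : set (finop A) :=
  range (fun s : S => Tagged (operation A) (interp A s)).
Arguments basic_ops {S} A _.

Definition is_hom (S : signature) (A B : finalgebra S) (h : A -> B) : Prop :=
  forall (s : S) (x : {ffun 'I_(arity s) -> A}),
    h (interp A s x) = interp B s [ffun i => h (x i)].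

Definition power (S : signature) (A : finalgebra S) (Y : finType) :
    finalgebra S :=
  @FinAlgebra S {ffun Y -> A}
    (fun s => [ffun x : {ffun 'I_(arity s) -> {ffun Y -> A}} =>
       [ffun y => interp A s [ffun i => x i y]]]).

Definition proj_op (A : finType) (n : nat) (i : 'I_n) : operation A n :=
  [ffun x : {ffun 'I_n -> A} => x i].

(* Main.v *)
Require Import Defs.
From HB Require Import structures.
From mathcomp Require Import all_boot all_algebra.
From mathcomp Require Import boolp classical_sets.

(* Reindexing along a map 'I_m -> Y turns an m-ary operation commuting with the
   basic operations into a homomorphism A^Y -> A, and every homomorphism arises
   this way when Y is finite.  Taking Y = A^n, commutation of f with the m-ary
   operation g at a matrix a is the equation h(f) = f(h(pi_i)_i) for the
   homomorphism h obtained from g and the columns j |-> (a_ij)_i of a. *)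

Set Implicit Arguments.
Unset Strict Implicit.
Unset Printing Implicit Defensive.

Local Open Scope classical_set_scope.

Definition reindex_hom (A Y : finType) m (g : operation A m) (c : 'I_m -> Y)
    (x : {ffun Y -> A}) : A :=
  g [ffun j => x (c j)].

(** Finiteness of [Y] makes this finitary: the enumeration of [Y] identifies A^Y with a finite power
    of [A]. *)
Definition op_of_hom (A Y : finType) (h : {ffun Y -> A} -> A) :
    operation A #|Y| :=
  [ffun x : {ffun 'I_#|Y| -> A} => h [ffun y => x (enum_rank y)]].

Lemma reindex_op_of_hom (A Y : finType) (h : {ffun Y -> A} -> A) :
  reindex_hom (op_of_hom h) enum_val =1 h.
Proof.
move=> x; rewrite /reindex_hom ffunE; congr h.
by apply/ffunP => y; rewrite !ffunE enum_rankK.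
Qed.

(** Precomposition with [c] is a homomorphism A^Y -> A^m, and commuting with the basic operations
    makes [g] a homomorphism A^m -> A. *)
Lemma reindex_hom_is_hom (S : signature) (A : finalgebra S) (Y : finType) m
    (g : operation A m) (c : 'I_m -> Y) :
  centralizer (basic_ops A) (Tagged (operation A) g) ->
  is_hom (A := power A Y) (B := A) (reindex_hom g c).
Proof.
move=> gC s x.
have /esym /= e := gC _ (imageT _ s) (\matrix_(i, j) x j (c i))%R.
rewrite /reindex_hom; apply: etrans (etrans e _).
  congr (g _); apply/ffunP => i; rewrite !ffunE.
  by congr (interp A s _); apply/ffunP => j; rewrite !ffunE mxE.
congr (interp A s _); apply/ffunP => j; rewrite !ffunE.
by congr (g _); apply/ffunP => i; rewrite !ffunE mxE.
Qed.

Lemma op_of_hom_centralizes (S : signature) (A : finalgebra S) (Y : finType)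
    (h : {ffun Y -> A} -> A) :
  is_hom (A := power A Y) (B := A) h ->
  centralizer (basic_ops A) (Tagged (operation A) (op_of_hom h)).
Proof.
move=> hh _ [s _ <-] a /=; rewrite [RHS]ffunE.
(* The arguments of [s] are the columns of [a], read as elements of A^Y. *)
have e := hh s [ffun j => [ffun y => a (enum_rank y) j]].
apply/esym; apply: etrans (etrans e _).
  congr h; apply/ffunP => y; rewrite !ffunE.
  by congr (interp A s _); apply/ffunP => j; rewrite !ffunE.
congr (interp A s _); apply/ffunP => j; rewrite !ffunE.
by congr h; apply/ffunP => y; rewrite !ffunE.
Qed.

(** With [c] listing the columns of a matrix, [reindex_hom g c] at [f] applies [f] to each column
    and then [g]; at [proj_op A i] it applies [g] to row [i]. *)
Lemma commuteP (A : finType) n m (f : operation A n) (g : operation A m) :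
  Defs.commute f g <->
  forall c : 'I_m -> {ffun 'I_n -> A},
    reindex_hom g c f = f [ffun i => reindex_hom g c (proj_op A i)].
Proof.
rewrite /reindex_hom; split=> [fg c | fg a].
  apply: etrans (etrans (fg (\matrix_(i, j) c j i)%R) _).
    congr (g _); apply/ffunP => j; rewrite !ffunE.
    by congr (f _); apply/ffunP => i; rewrite ffunE mxE.
  congr (f _); apply/ffunP => i; rewrite !ffunE.
  by congr (g _); apply/ffunP => j; rewrite !ffunE mxE.
rewrite (fg (fun j => [ffun i => a i j])).
congr (f _); apply/ffunP => i; rewrite !ffunE.
by congr (g _); apply/ffunP => j; rewrite !ffunE.
Qed.

Theorem corollary6p4 (S : signature) (A : finalgebra S) :
  double_centralizer (basic_ops A) =
  [set f : finop A |
    forall h : power A {ffun 'I_(tag f) -> A} -> A,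
      is_hom h ->
      h (tagged f) = tagged f [ffun i => h (proj_op A i)]].
Proof.
apply/seteqP; split=> -[n f] /= Hf => [h hh | [m g] gC]; last first.
  by apply/commuteP => c; exact/Hf/reindex_hom_is_hom.
(* The columns run through all of A^n, so reindexing [op_of_hom h] along [enum_val] gives back
   [h]. *)
have /commuteP/(_ enum_val) := Hf _ (op_of_hom_centralizes hh).
by rewrite (funext (reindex_op_of_hom h)).
Qed.
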